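(* Let $(Q_{i,j,k})_{(i,j,k)\in\mathbb{Z}^3}$ be a generic $3$-dimensional $Q$-net, with associated variables $Y^{*}_{i,j,k}$ and $\tilde Y^{*}_{i,j,k}$ ($*\in\{x,y,z\}$). Then for every $t\in\mathbb{Z}$ and all $i,j,k$ with $i+j+k=t$, $$\tilde{Y}_{i,j+1,k+1}^x=(Y_{i,j,k}^y)^{-1}\,\frac{1+Y_{i,j,k}^x+Y_{i,j,k}^yY_{i,j,k}^x}{1+Y_{i,j,k}^z+Y_{i,j,k}^zY_{i,j,k}^x},$$ $$Y_{i+1,j,k}^x=\tilde{Y}_{i+1,j,k}^x\,Y_{i+1,j-1,k}^x\,Y_{i+1,j-1,k}^y\,\frac{1+Y_{i+1,j,k-1}^z+Y_{i+1,j,k-1}^zY_{i+1,j,k-1}^x}{1+Y_{i+1,j-1,k}^x+Y_{i+1,j-1,k}^xY_{i+1,j-1,k}^y},$$ together with the cyclic shifts of these formulas, namely $$\tilde{Y}_{i+1,j,k+1}^y=(Y_{i,j,k}^z)^{-1}\,\frac{1+Y_{i,j,k}^y+Y_{i,j,k}^zY_{i,j,k}^y}{1+Y_{i,j,k}^x+Y_{i,j,k}^xY_{i,j,k}^y},\qquad \tilde{Y}_{i+1,j+1,k}^z=(Y_{i,j,k}^x)^{-1}\,\frac{1+Y_{i,j,k}^z+Y_{i,j,k}^xY_{i,j,k}^z}{1+Y_{i,j,k}^y+Y_{i,j,k}^yY_{i,j,k}^z},$$ $$Y_{i,j+1,k}^y=\tilde{Y}_{i,j+1,k}^y\,Y_{i,j+1,k-1}^y\,Y_{i,j+1,k-1}^z\,\frac{1+Y_{i-1,j+1,k}^x+Y_{i-1,j+1,k}^xY_{i-1,j+1,k}^y}{1+Y_{i,j+1,k-1}^y+Y_{i,j+1,k-1}^yY_{i,j+1,k-1}^z},$$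 $$Y_{i,j,k+1}^z=\tilde{Y}_{i,j,k+1}^z\,Y_{i-1,j,k+1}^z\,Y_{i-1,j,k+1}^x\,\frac{1+Y_{i,j-1,k+1}^y+Y_{i,j-1,k+1}^yY_{i,j-1,k+1}^z}{1+Y_{i-1,j,k+1}^z+Y_{i-1,j,k+1}^zY_{i-1,j,k+1}^x}.$$
   Context: A $3$-dimensional $Q$-net is a map $\mathbb{Z}^3\to\mathbb{R}^3$ (viewed in projective space), $(i,j,k)\mapsto Q_{i,j,k}$, such that for every unit square $u,u+e_a,u+e_b,u+e_a+e_b$ of $\mathbb{Z}^3$ the four corresponding points are coplanar. Generic means: the four points of each unit square have no three collinear; for each elementary cube with minimal corner $u$, the points at $u,u+e_1,u+e_2,u+e_3$ are not coplanar, and the planes spanned by the three faces at $u+e_1+e_2+e_3$ meet in exactly one point; and all quantities and fractions below are defined (with nonzero denominators). $Q^x_{i,j,k}$ is the line through $Q_{i,j,k}$ and $Q_{i+1,j,k}$; $Q^y_{i,j,k}$ the line through $Q_{i,j,k}$ and $Q_{i,j+1,k}$; $Q^z_{i,j,k}$ the line through $Q_{i,j,k}$ and $Q_{i,j,k+1}$. For collinear points in an affine chart, $[P_1,P_2,P_3,P_4]=\frac{P_1-P_2}{P_2-P_3}\cdot\frac{P_3-P_4}{P_4-P_1}$ (projectively invariant). Define $$Y^x_{i,j,k}=-[Q_{i,j,k},\,Q^x_{i,j,k}\cap Q^x_{i,j+1,k},\,Q_{i+1,j,k},\,Q^x_{i,j,k}\cap Q^x_{i,j,k+1}]^{-1},$$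 $$Y^y_{i,j,k}=-[Q_{i,j,k},\,Q^y_{i,j,k}\cap Q^y_{i,j,k+1},\,Q_{i,j+1,k},\,Q^y_{i,j,k}\cap Q^y_{i+1,j,k}]^{-1},$$ $$Y^z_{i,j,k}=-[Q_{i,j,k},\,Q^z_{i,j,k}\cap Q^z_{i+1,j,k},\,Q_{i,j,k+1},\,Q^z_{i,j,k}\cap Q^z_{i,j+1,k}]^{-1},$$ $$\tilde Y^x_{i,j,k}=-[Q_{i,j,k},\,Q^x_{i,j,k}\cap Q^x_{i,j,k-1},\,Q_{i+1,j,k},\,Q^x_{i,j,k}\cap Q^x_{i,j-1,k}]^{-1},$$ $$\tilde Y^y_{i,j,k}=-[Q_{i,j,k},\,Q^y_{i,j,k}\cap Q^y_{i-1,j,k},\,Q_{i,j+1,k},\,Q^y_{i,j,k}\cap Q^y_{i,j,k-1}]^{-1},$$ $$\tilde Y^z_{i,j,k}=-[Q_{i,j,k},\,Q^z_{i,j,k}\cap Q^z_{i,j-1,k},\,Q_{i,j,k+1},\,Q^z_{i,j,k}\cap Q^z_{i-1,j,k}]^{-1}.$$ The variables $\{Y^*_{i,j,k}:i+j+k=t\}\cup\{\tilde Y^*_{i,j,k}:i+j+k=t+1\}$ are the face weights at time $t$; the formulas express those at time $t+1$ in terms of those at time $t$. *)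

(* Defs.v *)
From HB Require Import structures.
From mathcomp Require Import all_boot all_order all_algebra.
From mathcomp Require Import classical_sets reals.
Set Implicit Arguments.
Unset Strict Implicit.
Unset Printing Implicit Defensive.
Import Order.TTheory GRing.Theory Num.Theory.
Local Open Scope ring_scope.

(* Real projective 3-space is handled through homogeneous coordinates: a point
   is a nonzero row vector of length 4 up to scaling, and lines and planes are
   row spaces of rank 2 and 3.  Intersection points of lines may therefore lie
   at infinity with respect to R^3. *)

Definition homog (R : realType) (p : 'rV[R]_3) : 'rV[R]_4 :=
  row_mx p (1%:M : 'M[R]_1).

Definition line (R : realType) (p q : 'rV[R]_3) : 'M[R]_4 :=
  (homog p + homog q)%MS.

Definition plane (R : realType) (p q r s : 'rV[R]_3) : 'M[R]_4 :=
  (homog p + homog q + homog r + homog s)%MS.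

Definition collinear (R : realType) (p q r : 'rV[R]_3) : bool :=
  (\rank (homog p + homog q + homog r)%MS <= 2)%N.

Definition coplanar (R : realType) (p q r s : 'rV[R]_3) : bool :=
  (\rank (homog p + homog q + homog r + homog s)%MS <= 3)%N.

(* A homogeneous coordinate vector of the common point of two lines that meet
   in exactly one point. *)
Definition meet (R : realType) (l m : 'M[R]_4) : 'rV[R]_4 :=
  nz_row (l :&: m)%MS.

(* The affine chart in which the plane p *m c = 0 is at infinity. *)
Definition in_chart (R : realType) (c : 'cV[R]_4) (p : 'rV[R]_4) : 'rV[R]_4 :=
  ((p *m c) 0 0)^-1 *: p.

(* The scalar a such that u = a *: v, for u parallel to v and v != 0; it is 0
   when v = 0. *)
Definition ratio (R : realType) (u v : 'rV[R]_4) : R := (u *m pinvmx v) 0 0.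

(* A chart in which p1, p2, p3 and p4 are all finite. *)
Definition common_chart (R : realType) (p1 p2 p3 p4 : 'rV[R]_4) : 'cV[R]_4 :=
  xget 0 [set c : 'cV[R]_4 |
    [/\ (p1 *m c) 0 0 != 0, (p2 *m c) 0 0 != 0,
        (p3 *m c) 0 0 != 0 & (p4 *m c) 0 0 != 0]]%classic.

Definition cross_ratio (R : realType) (p1 p2 p3 p4 : 'rV[R]_4) : R :=
  let c := common_chart p1 p2 p3 p4 in
  let P1 := in_chart c p1 in let P2 := in_chart c p2 in
  let P3 := in_chart c p3 in let P4 := in_chart c p4 in
  ratio (P1 - P2) (P2 - P3) * ratio (P3 - P4) (P4 - P1).

Section QNet.
Variable R : realType.
Implicit Types (Q : int -> int -> int -> 'rV[R]_3) (i j k : int).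

Definition for_unit_squares
    (P : 'rV[R]_3 -> 'rV[R]_3 -> 'rV[R]_3 -> 'rV[R]_3 -> Prop) Q : Prop :=
  forall i j k,
    [/\ P (Q i j k) (Q (i + 1) j k) (Q i (j + 1) k) (Q (i + 1) (j + 1) k),
        P (Q i j k) (Q i (j + 1) k) (Q i j (k + 1)) (Q i (j + 1) (k + 1)) &
        P (Q i j k) (Q i j (k + 1)) (Q (i + 1) j k) (Q (i + 1) j (k + 1))].

Definition is_Qnet Q : Prop :=
  for_unit_squares (fun p q r s => coplanar p q r s) Q.

Definition no_three_collinear (p q r s : 'rV[R]_3) : Prop :=
  [/\ ~~ collinear p q r, ~~ collinear p q s,
      ~~ collinear p r s & ~~ collinear q r s].

(* The planes of the three faces of the elementary cube with minimal corner
   (i, j, k) that contain its maximal corner. *)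
Definition far_face_x Q i j k :=
  plane (Q (i + 1) j k) (Q (i + 1) (j + 1) k)
        (Q (i + 1) j (k + 1)) (Q (i + 1) (j + 1) (k + 1)).
Definition far_face_y Q i j k :=
  plane (Q i (j + 1) k) (Q (i + 1) (j + 1) k)
        (Q i (j + 1) (k + 1)) (Q (i + 1) (j + 1) (k + 1)).
Definition far_face_z Q i j k :=
  plane (Q i j (k + 1)) (Q (i + 1) j (k + 1))
        (Q i (j + 1) (k + 1)) (Q (i + 1) (j + 1) (k + 1)).

Definition Qx Q i j k := line (Q i j k) (Q (i + 1) j k).
Definition Qy Q i j k := line (Q i j k) (Q i (j + 1) k).
Definition Qz Q i j k := line (Q i j k) (Q i j (k + 1)).

Definition Yx Q i j k : R :=
  - (cross_ratio (homog (Q i j k)) (meet (Qx Q i j k) (Qx Q i (j + 1) k))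
       (homog (Q (i + 1) j k)) (meet (Qx Q i j k) (Qx Q i j (k + 1))))^-1.

Definition Yy Q i j k : R :=
  - (cross_ratio (homog (Q i j k)) (meet (Qy Q i j k) (Qy Q i j (k + 1)))
       (homog (Q i (j + 1) k)) (meet (Qy Q i j k) (Qy Q (i + 1) j k)))^-1.

Definition Yz Q i j k : R :=
  - (cross_ratio (homog (Q i j k)) (meet (Qz Q i j k) (Qz Q (i + 1) j k))
       (homog (Q i j (k + 1))) (meet (Qz Q i j k) (Qz Q i (j + 1) k)))^-1.

Definition tYx Q i j k : R :=
  - (cross_ratio (homog (Q i j k)) (meet (Qx Q i j k) (Qx Q i j (k - 1)))
       (homog (Q (i + 1) j k)) (meet (Qx Q i j k) (Qx Q i (j - 1) k)))^-1.

Definition tYy Q i j k : R :=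
  - (cross_ratio (homog (Q i j k)) (meet (Qy Q i j k) (Qy Q (i - 1) j k))
       (homog (Q i (j + 1) k)) (meet (Qy Q i j k) (Qy Q i j (k - 1))))^-1.

Definition tYz Q i j k : R :=
  - (cross_ratio (homog (Q i j k)) (meet (Qz Q i j k) (Qz Q i (j - 1) k))
       (homog (Q i j (k + 1))) (meet (Qz Q i j k) (Qz Q (i - 1) j k)))^-1.

(* Since 0^-1 = 0 and ratio u 0 = 0, a weight is nonzero exactly when its
   cross-ratio has nonzero denominators and is itself invertible.  Thus the
   last two fields say that all weights and all fractions in the evolution
   formulas are defined. *)
Record generic Q : Prop := Generic {
  generic_square : for_unit_squares no_three_collinear Q;
  generic_corner : forall i j k,
    ~~ coplanar (Q i j k) (Q (i + 1) j k) (Q i (j + 1) k) (Q i j (k + 1));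
  generic_opposite_faces : forall i j k,
    \rank (far_face_x Q i j k :&: far_face_y Q i j k :&: far_face_z Q i j k)%MS
      = 1%N;
  generic_weights : forall i j k,
    [/\ Yx Q i j k != 0, Yy Q i j k != 0 & Yz Q i j k != 0] /\
    [/\ tYx Q i j k != 0, tYy Q i j k != 0 & tYz Q i j k != 0];
  generic_denominators : forall i j k,
    [/\ 1 + Yx Q i j k + Yx Q i j k * Yy Q i j k != 0,
        1 + Yy Q i j k + Yy Q i j k * Yz Q i j k != 0 &
        1 + Yz Q i j k + Yz Q i j k * Yx Q i j k != 0]
}.

End QNet.

(* Main.v *)
(* Each weight is a quotient of two slopes, where the slope of a point
   [s P + t Q] on an edge [PQ] is [t / s].  Expanding the last vertex of every
   face of one elementary cube in terms of its other three makes all slopes of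
   that cube explicit, and comparing the three expansions of the far vertex,
   relative to the corner basis, gives the relations between them.  These yield
   the formulas for the tilde weights directly; in those for [Y], the quotient
   [Y / tilde Y] on an edge splits into two slope quotients, one from each of
   the two cubes that contain the edge on its mixed sides. *)

Require Import Defs.
From HB Require Import structures.
From mathcomp Require Import all_boot all_order all_algebra.
From mathcomp Require Import classical_sets reals.
From mathcomp Require Import ring.
Set Implicit Arguments.
Unset Strict Implicit.
Import Order.TTheory GRing.Theory Num.Theory.
Local Open Scope ring_scope.


(** * Slopes on a projective line and the cross-ratio *)

(** The value depends on the representatives [P] and [Q], but not on the scaling of [w]; only
    quotients of slopes on one edge are projectively meaningful. *)
Definition slope (R : realType) (P Q w : 'rV[R]_4) : R :=
  let c : 'rV[R]_(1 + 1) := w *m pinvmx (col_mx P Q) in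
  c 0 (rshift 1 0) / c 0 (lshift 1 0).

Lemma slopeE (R : realType) (P Q : 'rV[R]_4) (s t : R) :
  row_free (col_mx P Q) -> slope P Q (s *: P + t *: Q) = t / s.
Proof.
move=> fPQ; rewrite /slope.
have -> : s *: P + t *: Q = row_mx s%:M t%:M *m col_mx P Q.
  by rewrite mul_row_col !mul_scalar_mx.
by rewrite mulmxKp // row_mxEr row_mxEl !mxE eqxx !mulr1n.
Qed.

Lemma slopeZ (R : realType) (P Q w : 'rV[R]_4) (k : R) :
  k != 0 -> slope P Q (k *: w) = slope P Q w.
Proof.
move=> k0; rewrite /slope -scalemxAl !mxE invfM mulrACA.
by rewrite mulfV ?mul1r.
Qed.

Lemma ratioZ (R : realType) (v : 'rV[R]_4) (a b : R) :
  v != 0 -> Defs.ratio (a *: v) (b *: v) = a / b.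
Proof.
move=> v0; rewrite /Defs.ratio.
(* For [b = 0] both sides are 0: the pseudo-inverse of the zero row vanishes, and [0^-1 = 0]. *)
have [->|b0] := eqVneq b 0.
  by rewrite scale0r /pinvmx mxrank0 pid_mx_0 mulmx0 mul0mx mulmx0 mxE invr0 mulr0.
have fv : row_free (b *: v).
  by rewrite /row_free rank_rV scaler_eq0 (negPf b0) (negPf v0).
have -> : a *: v = (a / b)%:M *m (b *: v).
  by rewrite mul_scalar_mx scalerA divfK.
by rewrite mulmxKp // mxE eqxx mulr1n.
Qed.

(** The numbers 0, ..., [size p - 1] are distinct in characteristic 0 and outnumber the possible
    roots. *)
Lemma poly_nonroot (R : realType) (p : {poly R}) :
  p != 0 -> exists x, p.[x] != 0.
Proof.
move=> p0; pose s : seq R := [seq n%:R | n <- iota 0 (size p)].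
case: (boolP (all (root p) s)) => [rs|/allPn[x _ px]]; last by exists x.
have us : uniq s.
  rewrite map_inj_uniq ?iota_uniq // => m n /eqP.
  by rewrite eqr_nat => /eqP.
by have := max_poly_roots p0 rs us; rewrite size_map size_iota ltnn.
Qed.

(* Evaluates each vector along the moment curve, where it vanishes only
   finitely often. *)
Lemma common_chart_exists (R : realType) (p1 p2 p3 p4 : 'rV[R]_4) :
  p1 != 0 -> p2 != 0 -> p3 != 0 -> p4 != 0 ->
  exists c : 'cV[R]_4,
    [/\ (p1 *m c) 0 0 != 0, (p2 *m c) 0 0 != 0,
        (p3 *m c) 0 0 != 0 & (p4 *m c) 0 0 != 0].
Proof.
move=> n1 n2 n3 n4.
have nz (p : 'rV[R]_4) : p != 0 -> rVpoly p != 0.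
  by apply: contra => /eqP p0; rewrite -(rVpolyK p) p0 raddf0.
have [] := poly_nonroot (p := rVpoly p1 * rVpoly p2 * (rVpoly p3 * rVpoly p4)).
  by rewrite !mulf_neq0 ?nz.
move=> x; rewrite !hornerM !mulf_eq0 !negb_or => /andP[/andP[h1 h2] /andP[h3 h4]].
have ev (p : 'rV[R]_4) : (p *m \col_i x ^+ i) 0 0 = (rVpoly p).[x].
  rewrite mxE (horner_coef_wide _ (size_poly _ _)).
  by apply: eq_bigr => i _; rewrite coef_rVpoly_ord mxE.
by exists (\col_i x ^+ i); rewrite !ev.
Qed.

Lemma cross_ratioE (R : realType) (P Q w w' : 'rV[R]_4) :
  row_free (col_mx P Q) -> w != 0 -> w' != 0 ->
  (w <= P + Q)%MS -> (w' <= P + Q)%MS ->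
  cross_ratio P w Q w' = slope P Q w / slope P Q w'.
Proof.
move=> fPQ w0 w'0 /sub_addsmxP[[a b] /= we] /sub_addsmxP[[a' b'] /= we'].
have lin (u v : R) : u *: P + v *: Q = 0 -> u = 0 /\ v = 0.
  have -> : u *: P + v *: Q = row_mx u%:M v%:M *m col_mx P Q.
    by rewrite mul_row_col !mul_scalar_mx.
  move=> /(congr1 (mulmx^~ (pinvmx (col_mx P Q)))).
  rewrite mulmxKp // mul0mx -row_mx0 => /eq_row_mx[/matrixP/(_ 0 0) + /matrixP/(_ 0 0)].
  by rewrite !mxE eqxx !mulr1n.
have nP : P != 0.
  apply/eqP=> P0; have [] := lin 1 0; first by rewrite P0 scaler0 scale0r addr0.
  by move/eqP; rewrite oner_eq0.
have nQ : Q != 0.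
  apply/eqP=> Q0; have [] := lin 0 1; first by rewrite Q0 scaler0 scale0r addr0.
  by move=> _ /eqP; rewrite oner_eq0.
rewrite [a]mx11_scalar [b]mx11_scalar !mul_scalar_mx in we.
rewrite [a']mx11_scalar [b']mx11_scalar !mul_scalar_mx in we'.
move: (a 0 0) (b 0 0) (a' 0 0) (b' 0 0) we we' => {b a b' a'} s t s' t' we we'.
rewrite [in RHS]we [in RHS]we' !slopeE // /cross_ratio.
have [c0 hc0] := common_chart_exists nP w0 nQ w'0.
have := xgetPex (0 : 'cV[R]_4) (ex_intro [set c : 'cV[R]_4 |
    [/\ (P *m c) 0 0 != 0, (w *m c) 0 0 != 0,
        (Q *m c) 0 0 != 0 & (w' *m c) 0 0 != 0]]%classic c0 hc0).
rewrite -/(common_chart P w Q w'); move: (common_chart _ _ _ _) => c /= [].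
rewrite /in_chart.
have ew : (w *m c) 0 0 = s * (P *m c) 0 0 + t * (Q *m c) 0 0.
  by rewrite we mulmxDl -!scalemxAl !mxE.
have ew' : (w' *m c) 0 0 = s' * (P *m c) 0 0 + t' * (Q *m c) 0 0.
  by rewrite we' mulmxDl -!scalemxAl !mxE.
move: ew ew'.
move: ((P *m c) 0 0) ((w *m c) 0 0) ((Q *m c) 0 0) ((w' *m c) 0 0).
move=> x1 x2 x3 x4 e2 e4 n1 n2 n3 n4.
(* [v] is the direction of the line in the chart; all four differences in the cross-ratio are
   multiples of it, so each [ratio] becomes a quotient of scalars. *)
set v := x1^-1 *: P - x3^-1 *: Q.
have v0 : v != 0.
  apply/eqP=> /eqP; rewrite /v -scaleNr => /eqP /lin [/eqP].
  by rewrite invr_eq0 (negPf n1).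
have comb (u u' z z' : R) : u = u' -> z = z' -> u *: P + z *: Q = u' *: P + z' *: Q.
  by move=> -> ->.
have -> : x1^-1 *: P - x2^-1 *: w = (t * x3 / x2) *: v.
  rewrite /v we !scalerDr scalerN !scalerA opprD addrA -scalerBl -!scaleNr.
  by apply: comb; rewrite e2 in n2 *; field; rewrite ?n1 ?n2 ?n3.
have -> : x2^-1 *: w - x3^-1 *: Q = (s * x1 / x2) *: v.
  rewrite /v we !scalerDr scalerN !scalerA -addrA -scalerBl -!scaleNr.
  by apply: comb; rewrite e2 in n2 *; field; rewrite ?n1 ?n2 ?n3.
have -> : x3^-1 *: Q - x4^-1 *: w' = (- (s' * x1 / x4)) *: v.
  rewrite /v we' !scalerDr scalerN !scalerA opprD addrCA -scalerBl -!scaleNr.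
  by apply: comb; rewrite e4 in n4 *; field; rewrite ?n1 ?n4 ?n3.
have -> : x4^-1 *: w' - x1^-1 *: P = (- (t' * x3 / x4)) *: v.
  rewrite /v we' !scalerDr scalerN !scalerA addrAC -scalerBl -!scaleNr.
  by apply: comb; rewrite e4 in n4 *; field; rewrite ?n1 ?n4 ?n3.
rewrite !ratioZ //.
(* If one of [s], [t'], [s'] vanishes, both sides are 0 by the convention [0^-1 = 0], so the
   identity holds without assuming a nondegenerate cross-ratio. *)
have [->|s0] := eqVneq s 0; first by rewrite !(mul0r, invr0, mulr0).
have [->|t'0] := eqVneq t' 0; first by rewrite !(mul0r, oppr0, invr0, mulr0).
have [->|s'0] := eqVneq s' 0; first by rewrite !(mul0r, oppr0, invr0, mulr0).
by field; rewrite n1 n2 n3 n4 s0 s'0 t'0.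
Qed.

(** * Linear dependence, collinearity and coplanarity *)

Section Incidence.
Variable R : realType.
Implicit Types p q r s x y z : 'rV[R]_3.

Lemma collinear_rot p q r : collinear p q r = collinear q r p.
Proof. by rewrite /collinear -addsmxA addsmxC. Qed.

Lemma collinear_swap p q r : collinear p q r = collinear q p r.
Proof. by rewrite /collinear (addsmxC (homog p)). Qed.

Lemma coplanar_rot p q r s : coplanar p q r s = coplanar p r s q.
Proof. by rewrite /coplanar -!addsmxA (addsmxC (homog q)) -!addsmxA. Qed.

Lemma coplanar_swap p q r s : coplanar p q r s = coplanar q p r s.
Proof. by rewrite /coplanar (addsmxC (homog p)). Qed.

(** With [c] nonzero, [w] would be a multiple of [u], hence lie in [A], and adding it could not
    raise the rank. *)
Lemma row_lincomb_eq0 (m : nat) (A : 'M[R]_(m, 4)) (u w : 'rV[R]_4) (c : R) :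
  (\rank A < \rank (A + w)%MS)%N -> (u <= A)%MS -> u + c *: w = 0 -> c = 0.
Proof.
move=> rA uA e; apply/eqP; apply: contraTT rA => c0.
rewrite -leqNgt; apply: mxrankS; rewrite addsmx_sub submx_refl /=.
have -> : w = - c^-1 *: u.
  have -> : u = - (c *: w) by apply/eqP; rewrite -addr_eq0 e.
  by rewrite scaleNr scalerN opprK scalerA mulVf // scale1r.
exact: scalemx_sub.
Qed.

Lemma rank_line_le p q : (\rank (homog p + homog q)%MS <= 2)%N.
Proof.
apply: leq_trans (mxrank_adds_leqif _ _) _.
exact: leq_add (rank_leq_row _) (rank_leq_row _).
Qed.

Lemma lincomb3_sub p q r (a b c : R) :
  ((a *: homog p + b *: homog q + c *: homog r)%R <= homog p + homog q + homog r)%MS.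
Proof. by rewrite !addmx_sub_adds ?scalemx_sub. Qed.

Lemma noncollinear_last p q r (a b c : R) : ~~ collinear p q r ->
  a *: homog p + b *: homog q + c *: homog r = 0 -> c = 0.
Proof.
rewrite -ltnNge => h; apply: (@row_lincomb_eq0 _ (homog p + homog q)%MS).
  exact: leq_ltn_trans (rank_line_le _ _) h.
by rewrite addmx_sub_adds ?scalemx_sub.
Qed.

Lemma noncoplanar_last p q r s (a b c d : R) : ~~ coplanar p q r s ->
  a *: homog p + b *: homog q + c *: homog r + d *: homog s = 0 -> d = 0.
Proof.
rewrite -ltnNge => h; apply: (@row_lincomb_eq0 _ (homog p + homog q + homog r)%MS).
  apply: leq_ltn_trans h; apply: leq_trans (mxrank_adds_leqif _ _) _.
  exact: leq_add (rank_line_le _ _) (rank_leq_row _).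
exact: lincomb3_sub.
Qed.

(** Uniqueness of coordinates in the corner basis. Each difference of coefficients is isolated by
    permuting the vertices until its own comes last. *)
Lemma noncoplanar_lincomb p x y z (a b c d a' b' c' d' : R) :
  ~~ coplanar p x y z ->
  a *: homog p + b *: homog x + c *: homog y + d *: homog z =
    a' *: homog p + b' *: homog x + c' *: homog y + d' *: homog z ->
  [/\ a = a', b = b', c = c' & d = d'].
Proof.
move=> h /eqP; rewrite -subr_eq0 => /eqP e.
have {e} e : (a - a') *: homog p + (b - b') *: homog x
           + (c - c') *: homog y + (d - d') *: homog z = 0.
  rewrite -e !scalerBl; apply/rowP=> i; rewrite !mxE; ring.
split; apply/eqP; rewrite -subr_eq0; apply/eqP.
- apply: (@noncoplanar_last x y z p (b - b') (c - c') (d - d')).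
    by rewrite -(coplanar_rot x p y z) coplanar_swap.
  rewrite -e; apply/rowP=> i; rewrite !mxE; ring.
- apply: (@noncoplanar_last p y z x (a - a') (c - c') (d - d')).
    by rewrite -coplanar_rot.
  rewrite -e; apply/rowP=> i; rewrite !mxE; ring.
- apply: (@noncoplanar_last p z x y (a - a') (d - d') (b - b')).
    by rewrite coplanar_rot.
  rewrite -e; apply/rowP=> i; rewrite !mxE; ring.
- exact: (@noncoplanar_last p x y z (a - a') (b - b') (c - c')).
Qed.

Lemma noncollinear_row_free p q r : ~~ collinear p q r ->
  row_free (col_mx (homog p) (homog q)).
Proof.
rewrite -ltnNge /row_free => h; rewrite -addsmxE eqn_leq rank_line_le /=.
rewrite -ltnS; apply: leq_trans h _; apply: leq_trans (mxrank_adds_leqif _ _) _.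
by rewrite -[X in (_ <= X)%N]addn1 leq_add2l rank_leq_row.
Qed.

(** The two lines have rank 2 and span rank 3, so they intersect in rank 1; any nonzero common
    vector spans the intersection, whichever row [nz_row] selects. *)
Lemma meet_coplanar_lines p q r s (w : 'rV[R]_4) :
  coplanar p q r s -> no_three_collinear p q r s -> w != 0 ->
  (w <= line p q)%MS -> (w <= line r s)%MS ->
  exists2 k, k != 0 & meet (line p q) (line r s) = k *: w.
Proof.
move=> cop [h1 _ _ h4] w0 w1 w2.
have rl (u v t : 'rV[R]_3) : ~~ collinear u v t -> \rank (line u v) = 2%N.
  by move=> /noncollinear_row_free; rewrite /row_free -addsmxE => /eqP.
have r2 : \rank (line r s) = 2%N by apply: (@rl r s q); rewrite -collinear_rot.
have rsum : \rank (line p q + line r s)%MS = 3%N.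
  rewrite /line addsmxA; apply/eqP; rewrite eqn_leq [X in X && _]cop /=.
  by move: h1; rewrite -ltnNge => /leq_trans; apply; exact: mxrankS (addsmxSl _ _).
have rc : \rank (line p q :&: line r s)%MS = 1%N.
  have := mxrank_sum_cap (line p q) (line r s).
  by rewrite rsum r2 (rl _ _ _ h1) => /eqP; rewrite -[(2 + 2)%N]/(3 + 1)%N eqn_add2l => /eqP.
have wc : (w <= line p q :&: line r s)%MS by rewrite sub_capmx w1 w2.
have : (meet (line p q) (line r s) <= w)%MS.
  apply: submx_trans (nz_row_sub _) _.
  by rewrite -(mxrank_leqif_sup wc).2 rc rank_rV w0.
case/sub_rVP => k ek; exists k => //; apply/eqP=> k0.
move/eqP: ek; rewrite k0 scale0r /meet nz_row_eq0 => /eqP e0.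
by rewrite e0 mxrank0 in rc.
Qed.

(** * Slopes on the edges of a planar quadrilateral *)

Definition edge_slope p q r s : R :=
  slope (homog p) (homog q) (meet (line p q) (line r s)).

(** By convention [s] is diagonal to [p]: the pairs of opposite sides are [pq], [rs] and [pr],
    [qs]. *)
Record quad p q r s : Prop := Quad {
  quad_coplanar : coplanar p q r s;
  quad_generic : no_three_collinear p q r s
}.

Lemma quad_swap p q r s : quad p q r s -> quad p r q s.
Proof.
case=> h [h1 h2 h3 h4]; split.
  by move: h; rewrite /coplanar -(addsmxA (homog p)) (addsmxC (homog q)) addsmxA.
split=> //; first by rewrite collinear_swap collinear_rot.
by rewrite collinear_swap.
Qed.

Lemma quad_rev p q r s : quad p q r s -> quad r s p q.
Proof.
case=> h [h1 h2 h3 h4]; split.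
  by move: h; rewrite /coplanar -addsmxA addsmxC addsmxA.
split.
- by rewrite -collinear_rot.
- by rewrite -collinear_rot.
- by rewrite collinear_rot.
- by rewrite collinear_rot.
Qed.

Lemma quad_lincomb p q r s : quad p q r s -> exists a b c : R,
  [/\ a != 0, b != 0, c != 0 &
      homog s = a *: homog p + b *: homog q + c *: homog r].
Proof.
case=> h [h1 h2 h3 h4].
have : (homog s <= homog p + homog q + homog r)%MS.
  have := (mxrank_leqif_sup (addsmxSl (homog p + homog q + homog r)%MS (homog s))).2.
  rewrite addsmx_sub submx_refl /= => <-.
  rewrite eqn_leq mxrankS ?addsmxSl //=.
  by apply: leq_trans h _; rewrite ltnNge.
case/sub_addsmxP=> -[u c] /= e; case/sub_addsmxP: (submxMl u (homog p + homog q)%MS).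
move=> [a b] /= e'; move: e; rewrite {}e' [a]mx11_scalar [b]mx11_scalar.
rewrite [c]mx11_scalar !mul_scalar_mx; move: (a 0 0) (b 0 0) (c 0 0).
move=> {}a {}b {}c e; exists a, b, c.
(* A vanishing coefficient leaves a dependence of [s] on two other vertices in which [s] has
   coefficient -1; noncollinearity would force that -1 to be 0. *)
have n1 : - 1 != 0 :> R by rewrite oppr_eq0 oner_eq0.
split=> //.
- apply: contraNneq n1 => a0; apply/eqP/(noncollinear_last (a := b) (b := c) h4).
  by rewrite e a0 scale0r add0r scaleN1r subrr.
- apply: contraNneq n1 => b0; apply/eqP/(noncollinear_last (a := a) (b := c) h3).
  by rewrite e b0 scale0r addr0 scaleN1r subrr.
- apply: contraNneq n1 => c0; apply/eqP/(noncollinear_last (a := a) (b := b) h2).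
  by rewrite e c0 scale0r addr0 scaleN1r subrr.
Qed.

Lemma quad_row_free p q r s : quad p q r s -> row_free (col_mx (homog p) (homog q)).
Proof. by case=> _ [/noncollinear_row_free]. Qed.

Lemma noncollinear_lincomb_neq0 p q r (a b : R) : ~~ collinear p q r -> a != 0 ->
  a *: homog p + b *: homog q != 0.
Proof.
move=> h a0; apply: contraNneq a0 => e; apply/eqP.
apply: (@noncollinear_last q r p b 0); first by rewrite -collinear_rot.
by rewrite scale0r addr0 addrC.
Qed.

(** The vector [a p + b q] equals [s - c r], so it lies on both lines. *)
Lemma meet_quad p q r s (a b c : R) : quad p q r s -> a != 0 ->
  homog s = a *: homog p + b *: homog q + c *: homog r ->
  exists2 k, k != 0 &
    meet (line p q) (line r s) = k *: (a *: homog p + b *: homog q).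
Proof.
move=> [cop h] a0 e; have [h1 _ _ _] := h; apply: meet_coplanar_lines => //.
- exact: noncollinear_lincomb_neq0 h1 a0.
- by rewrite addmx_sub_adds ?scalemx_sub.
- have -> : a *: homog p + b *: homog q = - c *: homog r + 1 *: homog s.
    by rewrite e scale1r scaleNr [RHS]addrC addrK.
  by rewrite addmx_sub_adds ?scalemx_sub.
Qed.

Lemma edge_slope_quad p q r s (a b c : R) : quad p q r s -> a != 0 ->
  homog s = a *: homog p + b *: homog q + c *: homog r ->
  edge_slope p q r s = b / a.
Proof.
move=> qd a0 e; have [k k0 ek] := meet_quad qd a0 e.
by rewrite /edge_slope ek slopeZ // slopeE // (quad_row_free qd).
Qed.

(** Solving the expansion for [q] gives [q = - (c / b) r + b^-1 s - (a / b) p], to which the slope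
    formula applies with [r], [s] as the edge. *)
Lemma edge_slope_quad_rev p q r s (a b c : R) : quad p q r s ->
  b != 0 -> c != 0 ->
  homog s = a *: homog p + b *: homog q + c *: homog r ->
  edge_slope r s p q = - c^-1.
Proof.
move=> qd b0 c0 e.
rewrite (@edge_slope_quad r s p q (- (c / b)) (b^-1) (- (a / b))).
- by field; rewrite b0 c0.
- exact: quad_rev.
- by rewrite oppr_eq0 mulf_neq0 ?invr_eq0.
- by rewrite e; apply/rowP=> i; rewrite !mxE; field.
Qed.

Lemma edge_slope_neq0 p q r s : quad p q r s -> edge_slope p q r s != 0.
Proof.
move=> h; have [a [b [c [a0 b0 c0 e]]]] := quad_lincomb h.
by rewrite (edge_slope_quad h a0 e) mulf_neq0 ?invr_eq0.
Qed.

Lemma quad_cross_ratio p q r s r' s' : quad p q r s -> quad p q r' s' ->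
  cross_ratio (homog p) (meet (line p q) (line r s)) (homog q)
              (meet (line p q) (line r' s'))
  = edge_slope p q r s / edge_slope p q r' s'.
Proof.
have meet_sub (t u : 'rV[R]_3) : quad p q t u ->
    (meet (line p q) (line t u) != 0) /\
    (meet (line p q) (line t u) <= homog p + homog q)%MS.
  move=> h; have [a [b [c [a0 b0 c0 e]]]] := quad_lincomb h.
  have [k k0 ->] := meet_quad h a0 e; have [_ [h1 _ _ _]] := h.
  rewrite scaler_eq0 (negPf k0) (noncollinear_lincomb_neq0 _ h1) //.
  by rewrite scalemx_sub // addmx_sub_adds ?scalemx_sub.
move=> h h'; have [w0 sw] := meet_sub _ _ h; have [w0' sw'] := meet_sub _ _ h'.
by rewrite cross_ratioE // (quad_row_free h).
Qed.

(** * Weights and slopes in one elementary cube *)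

(** Common form of all six families of weights: an edge [pq] and two faces through it, given by
    their sides [rs] and [r's'] opposite to [pq]. *)
Definition weight p q r s r' s' : R :=
  - (edge_slope p q r s / edge_slope p q r' s')^-1.

(** [p] is the minimal corner, [x], [y], [z] its neighbours, [q12], [q23], [q31] complete the faces
    at [p], and [o] is the far vertex. The labelling is cyclic, so one computation serves all three
    axes. *)
Definition cube p x y z q12 q23 q31 o : Prop :=
  [/\ ~~ coplanar p x y z,
      [/\ quad p x y q12, quad p y z q23 & quad p z x q31] &
      [/\ quad x q12 q31 o, quad y q23 q12 o & quad z q31 q23 o]].

Lemma cube_rot p x y z q12 q23 q31 o :
  cube p x y z q12 q23 q31 o -> cube p y z x q23 q31 q12 o.
Proof. by case=> h [h1 h2 h3] [h4 h5 h6]; split=> //; rewrite -coplanar_rot. Qed.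

(** The first identity is the formula for the tilde weight. The other two give the slope quotients
    on the edges [y q12] and [z q31], each of which has one face at [p] and one at [o]. *)
Lemma cube_weights p x y z q12 q23 q31 o : cube p x y z q12 q23 q31 o ->
  let Wx := weight p x y q12 z q31 in
  let Wy := weight p y z q23 x q12 in
  let Wz := weight p z x q31 y q23 in
  [/\ 1 + Wz + Wz * Wx != 0 ->
        weight q23 o y q12 z q31 =
        Wy^-1 * ((1 + Wx + Wy * Wx) / (1 + Wz + Wz * Wx)),
      1 + Wx + Wx * Wy != 0 ->
        edge_slope y q12 q23 o / edge_slope y q12 p x =
        Wx * Wy / (1 + Wx + Wx * Wy) &
      edge_slope z q31 p x / edge_slope z q31 q23 o = 1 + Wz + Wz * Wx].
Proof.
case=> ncop [f12 f23 f31] [g1 g2 g3].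
have [a3 [b3 [c3 [a3n b3n c3n e12]]]] := quad_lincomb f12.
have [a1 [b1 [c1 [a1n b1n c1n e23]]]] := quad_lincomb f23.
have [a2 [b2 [c2 [a2n b2n c2n e31]]]] := quad_lincomb f31.
have [n [e [f [nn en fn ox]]]] := quad_lincomb g1.
have [m [r [s [mn rn sn oy]]]] := quad_lincomb g2.
have [m' [s' [r' [m'n s'n r'n oz]]]] := quad_lincomb g3.
(* Faces are used for both of their pairs of opposite sides, which needs the expansion in either
   order. *)
have swap u v w t a b c : homog t = a *: homog u + b *: homog v + c *: homog w ->
    homog t = a *: homog u + c *: homog w + b *: homog v :> 'rV[R]_4.
  by rewrite addrAC.
rewrite /weight.
rewrite (edge_slope_quad f12 a3n e12) (edge_slope_quad f23 a1n e23).
rewrite (edge_slope_quad f31 a2n e31).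
rewrite (edge_slope_quad (quad_swap f12) a3n (swap _ _ _ _ _ _ _ e12)).
rewrite (edge_slope_quad (quad_swap f23) a1n (swap _ _ _ _ _ _ _ e23)).
rewrite (edge_slope_quad (quad_swap f31) a2n (swap _ _ _ _ _ _ _ e31)).
rewrite (edge_slope_quad_rev f12 b3n c3n e12).
rewrite (edge_slope_quad_rev (quad_swap f31) c2n b2n (swap _ _ _ _ _ _ _ e31)).
rewrite (edge_slope_quad_rev (quad_swap g2) sn rn (swap _ _ _ _ _ _ _ oy)).
rewrite (edge_slope_quad_rev g3 s'n r'n oz).
rewrite (edge_slope_quad (quad_swap g2) mn (swap _ _ _ _ _ _ _ oy)).
rewrite (edge_slope_quad g3 m'n oz).
rewrite e12 e23 in oy; rewrite e31 e23 in oz; rewrite e12 e31 in ox.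
have oyE : homog o = (r * a1 + s * a3) *: homog p + (s * b3) *: homog x
    + (m + r * b1 + s * c3) *: homog y + (r * c1) *: homog z.
  by rewrite oy; apply/rowP=> l; rewrite !mxE; ring.
have ozE : homog o = (s' * a2 + r' * a1) *: homog p + (s' * c2) *: homog x
    + (r' * b1) *: homog y + (m' + s' * b2 + r' * c1) *: homog z.
  by rewrite oz; apply/rowP=> l; rewrite !mxE; ring.
have oxE : homog o = (e * a3 + f * a2) *: homog p + (n + e * b3 + f * c2) *: homog x
    + (e * c3) *: homog y + (f * b2) *: homog z.
  by rewrite ox; apply/rowP=> l; rewrite !mxE; ring.
have [h1 h2 h3 h4] := noncoplanar_lincomb ncop (etrans (esym oyE) ozE).
have [k1 _ k3 k4] := noncoplanar_lincomb ncop (etrans (esym ozE) oxE).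
have k4' : r * c1 = f * b2 by rewrite h4.
have se : s = s' * c2 / b3 by rewrite -h2 mulfK.
have ee : e = r' * b1 / c3 by rewrite k3 mulfK.
have fe : f = r * c1 / b2 by rewrite k4' mulfK.
have me : m = r' * b1 - r * b1 - s * c3 by rewrite -h3; ring.
have m'e : m' = r * c1 - s' * b2 - r' * c1 by rewrite h4; ring.
clear oy oz ox oyE ozE oxE h2 h3 h4 k3 k4 k4' e12 e23 e31 swap.
(* Now [s], [e], [f], [m], [m'] and [r] are determined by [r'], [s'] and the faces at [p]. The one
   relation left is [k1], the [p] coordinate, which only the first identity requires. *)
have re : r = r' + s' * (a2 - c2 * a3 / b3) / a1.
  have -> : r = (r * a1 + s * a3 - s * a3) / a1 by field.
  by rewrite h1 se; field; rewrite a1n b3n.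
have -> : - (b3 / a3 / (c2 / a2))^-1 = - (c2 * a3 / (a2 * b3)).
  by field; rewrite a2n a3n b3n c2n.
have -> : - (b1 / a1 / (c3 / a3))^-1 = - (c3 * a1 / (a3 * b1)).
  by field; rewrite a1n a3n b1n c3n.
have -> : - (b2 / a2 / (c1 / a1))^-1 = - (c1 * a2 / (a1 * b2)).
  by field; rewrite a1n a2n b2n c1n.
split.
- set N := (X in _ * (X / _)); set D := (X in _ / X) => D0.
  have -> : - (- r^-1 / - r'^-1)^-1 = - r / r' by field; rewrite rn r'n.
  rewrite mulrA; apply/eqP; rewrite eqr_div //.
  (* The tilde weight is [- r / r']. After multiplication by [Wy], the cross-multiplied identity has
     defect [k1] times [c3 / (a3 * b1) * (1 + Wx)]. *)
  have nW : - (c3 * a1 / (a3 * b1)) != 0.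
    by rewrite oppr_eq0 !mulf_neq0 // invr_eq0 mulf_neq0.
  rewrite -(inj_eq (mulfI nW)) -subr_eq0.
  have -> : - (c3 * a1 / (a3 * b1)) * (- r * D)
          - - (c3 * a1 / (a3 * b1)) * ((- (c3 * a1 / (a3 * b1)))^-1 * N * r')
      = (c3 / (a3 * b1)) * (1 - c2 * a3 / (a2 * b3))
        * (s' * a2 + r' * a1 - (e * a3 + f * a2)).
    rewrite /N /D ee fe re.
    by field; rewrite a1n a2n a3n b1n b2n b3n c3n.
  by rewrite k1 subrr mulr0.
- set D := (X in _ / X) => D0.
  have -> : s / m / - c3^-1 = - (s * c3) / m by field; rewrite mn c3n.
  apply/eqP; rewrite eqr_div // /D me se re; apply/eqP.
  by field; rewrite a1n a2n a3n b1n b3n.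
- have -> : - b2^-1 / (s' / m') = - m' / (b2 * s') by field; rewrite b2n s'n m'n.
  by rewrite m'e re; field; rewrite a1n a2n b2n b3n s'n.
Qed.

End Incidence.

(** * The weights of the net as weights of faces *)

Section Weights.
Variables (R : realType) (Q : int -> int -> int -> 'rV[R]_3).
Hypotheses (hQ : is_Qnet Q) (hgen : generic Q).

Lemma generic_quads i j k :
  [/\ quad (Q i j k) (Q (i + 1) j k) (Q i (j + 1) k) (Q (i + 1) (j + 1) k),
      quad (Q i j k) (Q i (j + 1) k) (Q i j (k + 1)) (Q i (j + 1) (k + 1)) &
      quad (Q i j k) (Q i j (k + 1)) (Q (i + 1) j k) (Q (i + 1) j (k + 1))].
Proof.
have [c1 c2 c3] := hQ i j k; have [n1 n2 n3] := generic_square hgen i j k.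
by split; split.
Qed.

Lemma generic_cube i j k :
  cube (Q i j k) (Q (i + 1) j k) (Q i (j + 1) k) (Q i j (k + 1))
    (Q (i + 1) (j + 1) k) (Q i (j + 1) (k + 1)) (Q (i + 1) j (k + 1))
    (Q (i + 1) (j + 1) (k + 1)).
Proof.
split; [exact: generic_corner | exact: generic_quads |].
have [_ ? _] := generic_quads (i + 1) j k.
have [_ _ ?] := generic_quads i (j + 1) k.
by have [? _ _] := generic_quads i j (k + 1).
Qed.

Lemma YxE i j k : Yx Q i j k =
  weight (Q i j k) (Q (i + 1) j k) (Q i (j + 1) k) (Q (i + 1) (j + 1) k)
         (Q i j (k + 1)) (Q (i + 1) j (k + 1)).
Proof.
have [h1 h2 h3] := generic_quads i j k.
by rewrite /Yx /Qx quad_cross_ratio //; apply: quad_swap.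
Qed.

Lemma YyE i j k : Yy Q i j k =
  weight (Q i j k) (Q i (j + 1) k) (Q i j (k + 1)) (Q i (j + 1) (k + 1))
         (Q (i + 1) j k) (Q (i + 1) (j + 1) k).
Proof.
have [h1 h2 h3] := generic_quads i j k.
by rewrite /Yy /Qy quad_cross_ratio //; apply: quad_swap.
Qed.

Lemma YzE i j k : Yz Q i j k =
  weight (Q i j k) (Q i j (k + 1)) (Q (i + 1) j k) (Q (i + 1) j (k + 1))
         (Q i (j + 1) k) (Q i (j + 1) (k + 1)).
Proof.
have [h1 h2 h3] := generic_quads i j k.
by rewrite /Yz /Qz quad_cross_ratio //; apply: quad_swap.
Qed.

(** The faces behind the edge come from the squares whose minimal corner is one step lower; their
    order is that of the faces in the tilde weight. *)
Lemma generic_quads_x_back i j k :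
  quad (Q i j k) (Q (i + 1) j k) (Q i j (k - 1)) (Q (i + 1) j (k - 1)) /\
  quad (Q i j k) (Q (i + 1) j k) (Q i (j - 1) k) (Q (i + 1) (j - 1) k).
Proof.
have [h1 _ _] := generic_quads i (j - 1) k; rewrite subrK in h1.
have [_ _ h3] := generic_quads i j (k - 1); rewrite subrK in h3.
by split; apply: quad_rev => //; apply: quad_swap.
Qed.

Lemma generic_quads_y_back i j k :
  quad (Q i j k) (Q i (j + 1) k) (Q (i - 1) j k) (Q (i - 1) (j + 1) k) /\
  quad (Q i j k) (Q i (j + 1) k) (Q i j (k - 1)) (Q i (j + 1) (k - 1)).
Proof.
have [_ h2 _] := generic_quads i j (k - 1); rewrite subrK in h2.
have [h1 _ _] := generic_quads (i - 1) j k; rewrite subrK in h1.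
by split; apply: quad_rev => //; apply: quad_swap.
Qed.

Lemma generic_quads_z_back i j k :
  quad (Q i j k) (Q i j (k + 1)) (Q i (j - 1) k) (Q i (j - 1) (k + 1)) /\
  quad (Q i j k) (Q i j (k + 1)) (Q (i - 1) j k) (Q (i - 1) j (k + 1)).
Proof.
have [_ h2 _] := generic_quads i (j - 1) k; rewrite subrK in h2.
have [_ _ h3] := generic_quads (i - 1) j k; rewrite subrK in h3.
by split; apply: quad_rev => //; apply: quad_swap.
Qed.

Lemma tYxE i j k : tYx Q i j k =
  weight (Q i j k) (Q (i + 1) j k) (Q i j (k - 1)) (Q (i + 1) j (k - 1))
         (Q i (j - 1) k) (Q (i + 1) (j - 1) k).
Proof.
have [h h'] := generic_quads_x_back i j k.
by rewrite /tYx /Qx quad_cross_ratio.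
Qed.

Lemma tYyE i j k : tYy Q i j k =
  weight (Q i j k) (Q i (j + 1) k) (Q (i - 1) j k) (Q (i - 1) (j + 1) k)
         (Q i j (k - 1)) (Q i (j + 1) (k - 1)).
Proof.
have [h h'] := generic_quads_y_back i j k.
by rewrite /tYy /Qy quad_cross_ratio.
Qed.

Lemma tYzE i j k : tYz Q i j k =
  weight (Q i j k) (Q i j (k + 1)) (Q i (j - 1) k) (Q i (j - 1) (k + 1))
         (Q (i - 1) j k) (Q (i - 1) j (k + 1)).
Proof.
have [h h'] := generic_quads_z_back i j k.
by rewrite /tYz /Qz quad_cross_ratio.
Qed.

End Weights.

(** * Evolution of the weights *)

(** The quotient of the two weights regroups into the slope quotient of [r's'] and [u'v'] times that
    of [uv] and [rs]; each pairs a forward face with a backward one, so it lives in a single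
    cube. *)
Lemma weight_evolution (R : realType) (p q r s r' s' u v u' v' : 'rV[R]_3)
    (Y Y' N D : R) :
  quad p q u v /\ quad p q u' v' ->
  edge_slope p q r' s' / edge_slope p q u' v' = Y * Y' / D ->
  edge_slope p q u v / edge_slope p q r s = N ->
  weight p q r s r' s' = weight p q u v u' v' * Y * Y' * (N / D).
Proof.
case=> /edge_slope_neq0 h /edge_slope_neq0 h' e <-.
rewrite (mulrC _ D^-1) mulrA -2!(mulrA (weight _ _ _ _ _ _)) -e.
rewrite /weight !(invf_div (edge_slope _ _ _ _) (edge_slope _ _ _ _)).
(* Only the slopes for [uv] and [u'v'] have to cancel; generalizing the remaining inverse spares a
   nonvanishing condition. *)
by move: (edge_slope p q r s)^-1 => a; field; rewrite h h'.
Qed.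

Theorem proposition4p12 (R : realType) (Q : int -> int -> int -> 'rV[R]_3)
    (hQ : is_Qnet Q) (hgen : generic Q)
    (t i j k : int) (ht : i + j + k = t) :
  (tYx Q i (j + 1) (k + 1) =
     (Yy Q i j k)^-1 *
     ((1 + Yx Q i j k + Yy Q i j k * Yx Q i j k) /
      (1 + Yz Q i j k + Yz Q i j k * Yx Q i j k))) /\
  (Yx Q (i + 1) j k =
     tYx Q (i + 1) j k * Yx Q (i + 1) (j - 1) k * Yy Q (i + 1) (j - 1) k *
     ((1 + Yz Q (i + 1) j (k - 1)
         + Yz Q (i + 1) j (k - 1) * Yx Q (i + 1) j (k - 1)) /
      (1 + Yx Q (i + 1) (j - 1) k
         + Yx Q (i + 1) (j - 1) k * Yy Q (i + 1) (j - 1) k))) /\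
  (tYy Q (i + 1) j (k + 1) =
     (Yz Q i j k)^-1 *
     ((1 + Yy Q i j k + Yz Q i j k * Yy Q i j k) /
      (1 + Yx Q i j k + Yx Q i j k * Yy Q i j k))) /\
  (tYz Q (i + 1) (j + 1) k =
     (Yx Q i j k)^-1 *
     ((1 + Yz Q i j k + Yx Q i j k * Yz Q i j k) /
      (1 + Yy Q i j k + Yy Q i j k * Yz Q i j k))) /\
  (Yy Q i (j + 1) k =
     tYy Q i (j + 1) k * Yy Q i (j + 1) (k - 1) * Yz Q i (j + 1) (k - 1) *
     ((1 + Yx Q (i - 1) (j + 1) k
         + Yx Q (i - 1) (j + 1) k * Yy Q (i - 1) (j + 1) k) /
      (1 + Yy Q i (j + 1) (k - 1)
         + Yy Q i (j + 1) (k - 1) * Yz Q i (j + 1) (k - 1)))) /\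
  (Yz Q i j (k + 1) =
     tYz Q i j (k + 1) * Yz Q (i - 1) j (k + 1) * Yx Q (i - 1) j (k + 1) *
     ((1 + Yy Q i (j - 1) (k + 1)
         + Yy Q i (j - 1) (k + 1) * Yz Q i (j - 1) (k + 1)) /
      (1 + Yz Q (i - 1) j (k + 1)
         + Yz Q (i - 1) j (k + 1) * Yx Q (i - 1) j (k + 1)))).
Proof.
(* The cube identities in the three cyclic labellings, one for each edge direction. *)
have cx l m n := cube_weights (generic_cube hQ hgen l m n).
have cy l m n := cube_weights (cube_rot (generic_cube hQ hgen l m n)).
have cz l m n := cube_weights (cube_rot (cube_rot (generic_cube hQ hgen l m n))).
have d := generic_denominators hgen.
split; [|split; [|split; [|split; [|split]]]].
- have [e _ _] := cx i j k; have [_ _ dz] := d i j k.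
  rewrite -?YxE // -?YyE // -?YzE // in e.
  by rewrite tYxE // !addrK; apply: e.
(* The edge is [y q12] in the first cube and [z q31] in the second. The first supplies the two
   weight factors and the denominator, the second the numerator. *)
- have [_ e _] := cx (i + 1) (j - 1) k; have [_ _ e'] := cx (i + 1) j (k - 1).
  have [dx _ _] := d (i + 1) (j - 1) k.
  rewrite -?YxE // -?YyE // -?YzE // in e; rewrite -?YxE // -?YyE // -?YzE // in e'.
  move/(_ dx): e => e; rewrite !subrK in e; rewrite !subrK in e'.
  rewrite [LHS]YxE // tYxE //.
  exact: weight_evolution (generic_quads_x_back hQ hgen (i + 1) j k) e e'.
- have [e _ _] := cy i j k; have [dx _ _] := d i j k.
  rewrite -?YxE // -?YyE // -?YzE // in e.
  by rewrite tYyE // !addrK; apply: e.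
- have [e _ _] := cz i j k; have [_ dy _] := d i j k.
  rewrite -?YxE // -?YyE // -?YzE // in e.
  by rewrite tYzE // !addrK; apply: e.
- have [_ e _] := cy i (j + 1) (k - 1); have [_ _ e'] := cy (i - 1) (j + 1) k.
  have [_ dy _] := d i (j + 1) (k - 1).
  rewrite -?YxE // -?YyE // -?YzE // in e; rewrite -?YxE // -?YyE // -?YzE // in e'.
  move/(_ dy): e => e; rewrite !subrK in e; rewrite !subrK in e'.
  rewrite [LHS]YyE // tYyE //.
  exact: weight_evolution (generic_quads_y_back hQ hgen i (j + 1) k) e e'.
- have [_ e _] := cz (i - 1) j (k + 1); have [_ _ e'] := cz i (j - 1) (k + 1).
  have [_ _ dz] := d (i - 1) j (k + 1).
  rewrite -?YxE // -?YyE // -?YzE // in e; rewrite -?YxE // -?YyE // -?YzE // in e'.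
  move/(_ dz): e => e; rewrite !subrK in e; rewrite !subrK in e'.
  rewrite [LHS]YzE // tYzE //.
  exact: weight_evolution (generic_quads_z_back hQ hgen i j (k + 1)) e e'.
Qed.
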